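(* Work in $\mathsf{ZF}$. Let $\kappa$ be a cardinal and $\mathbb{P}$ a notion of forcing. If $\mathbb{P}$ is $\kappa$-descending distributive then $\mathbb{P}$ does not change the cofinality of $\kappa$.
   Context: The base theory is $\mathsf{ZF}$ (no axiom of choice). ''Cardinal'' means an initial ordinal. A notion of forcing is a partial order with a maximum element, assumed throughout to be separative (if $p'\nleq p$ then there is $q\leq p'$ incompatible with $p$); $q\leq p$ means $q$ is stronger. A subset is open if it is closed under passing to stronger conditions, and dense if every condition has a stronger condition in it. $\mathbb{P}$ is $\kappa$-descending distributive if for every decreasing sequence $\langle D_\alpha\mid\alpha<\kappa\rangle$ of open dense subsets of $\mathbb{P}$ (i.e. $D_\alpha\supseteq D_\beta$ for $\alpha<\beta<\kappa$), the intersection $\bigcap_{\alpha<\kappa}D_\alpha$ is open dense. ''Does not change the cofinality of $\kappa$'' means $\operatorname{cf}^{V[G]}(\kappa)=\operatorname{cf}^{V}(\kappa)$ for every $V$-generic $G\subseteq\mathbb{P}$. *)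

(* Defs.v *)
(* Forcing over an arbitrary model of ZF.  The ground universe V is any
   structure (M, E) satisfying ZF; by completeness, a statement proved for all
   of them is a theorem of ZF.  Replacement and Separation are first-order
   schemas, and Choice is not assumed inside V. *)

Set Implicit Arguments.
Unset Strict Implicit.
Unset Printing Implicit Defensive.

Record structure : Type := Structure {
  carrier :> Type;
  mem : carrier -> carrier -> Prop
}.

Arguments mem {s} _ _.

Declare Scope zf_scope.
Delimit Scope zf_scope with zf.
Notation "x ∈ y" := (mem x y) (at level 70, no associativity) : zf_scope.
Local Open Scope zf_scope.

(* First-order formulas of the language of set theory, variables being de
   Bruijn indices.  Parameters are supplied by the environment. *)
Inductive formula : Type :=
| fMem (i k : nat)
| fEq (i k : nat)
| fBot
| fImp (A B : formula)
| fAnd (A B : formula)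
| fOr (A B : formula)
| fAll (A : formula)
| fEx (A : formula).

Definition push (T : Type) (x : T) (e : nat -> T) : nat -> T :=
  fun n => match n with O => x | S m => e m end.

Fixpoint sat (M : structure) (e : nat -> M) (A : formula) {struct A} : Prop :=
  match A with
  | fMem i k => e i ∈ e k
  | fEq i k => e i = e k
  | fBot => False
  | fImp A B => sat e A -> sat e B
  | fAnd A B => sat e A /\ sat e B
  | fOr A B => sat e A \/ sat e B
  | fAll A => forall x : M, sat (push x e) A
  | fEx A => exists x : M, sat (push x e) A
  end.

Record ZF (M : structure) : Prop := {
  zf_extensionality : forall a b : M, (forall x, x ∈ a <-> x ∈ b) -> a = b;
  zf_foundation : forall a : M,
    (exists x, x ∈ a) -> exists x, x ∈ a /\ ~ (exists y, y ∈ x /\ y ∈ a);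
  zf_pairing : forall a b : M, exists c, forall x, x ∈ c <-> x = a \/ x = b;
  zf_union : forall a : M,
    exists u, forall x, x ∈ u <-> exists y, y ∈ a /\ x ∈ y;
  zf_powerset : forall a : M,
    exists p, forall x, x ∈ p <-> (forall y, y ∈ x -> y ∈ a);
  zf_infinity : exists a : M,
    (exists o, o ∈ a /\ forall x, ~ x ∈ o) /\
    (forall x, x ∈ a ->
       exists s, s ∈ a /\ forall y, y ∈ s <-> y ∈ x \/ y = x);
  zf_separation : forall (A : formula) (e : nat -> M) (a : M),
    exists b, forall x, x ∈ b <-> x ∈ a /\ sat (push x e) A;
  (* variable 0 is the value, variable 1 the argument *)
  zf_replacement : forall (A : formula) (e : nat -> M) (a : M),
    (forall x, x ∈ a -> exists! y, sat (push y (push x e)) A) ->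
    exists b, forall y,
      y ∈ b <-> exists x, x ∈ a /\ sat (push y (push x e)) A
}.

Section Internal.
(* All quantifiers range over M, so each notion below is the relativization
   to M of the usual set-theoretic one. *)
Variable M : structure.
Implicit Types (a b f g k p q r x y z w A B D P le one : M).

Definition subset a b : Prop := forall x, x ∈ a -> x ∈ b.

Definition is_upair x y z : Prop := forall w, w ∈ z <-> w = x \/ w = y.

(* z = {{x}, {x, y}} *)
Definition is_pair x y z : Prop :=
  exists a b, is_upair x x a /\ is_upair x y b /\ is_upair a b z.

Definition pair_in x y r : Prop := exists z, is_pair x y z /\ z ∈ r.

Definition function_on f A : Prop :=
  (forall z, z ∈ f -> exists x y, x ∈ A /\ is_pair x y z) /\
  (forall x, x ∈ A -> exists! y, pair_in x y f).

Definition function_to f A B : Prop :=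
  function_on f A /\ (forall x y, pair_in x y f -> y ∈ B).

Definition bijection f A B : Prop :=
  function_to f A B /\
  (forall x x' y, pair_in x y f -> pair_in x' y f -> x = x') /\
  (forall y, y ∈ B -> exists x, pair_in x y f).

Definition transitive a : Prop := forall x, x ∈ a -> subset x a.

Definition well_ordered_by_mem a : Prop :=
  (forall x, x ∈ a -> ~ x ∈ x) /\
  (forall x y z, x ∈ a -> y ∈ a -> z ∈ a -> x ∈ y -> y ∈ z -> x ∈ z) /\
  (forall x y, x ∈ a -> y ∈ a -> x ∈ y \/ x = y \/ y ∈ x) /\
  (forall b, subset b a -> (exists x, x ∈ b) ->
     exists x, x ∈ b /\ forall y, y ∈ b -> x = y \/ x ∈ y).

Definition ordinal a : Prop := transitive a /\ well_ordered_by_mem a.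

Definition cardinal k : Prop :=
  ordinal k /\ ~ (exists a f, a ∈ k /\ bijection f a k).

Definition cofinal_map f a k : Prop :=
  function_to f a k /\
  forall x, x ∈ k -> exists b y, pair_in b y f /\ (x = y \/ x ∈ y).

(* a = cf(k): the least ordinal that is mapped cofinally into k *)
Definition is_cofinality k a : Prop :=
  ordinal a /\ (exists f, cofinal_map f a k) /\
  forall b, ordinal b -> (exists f, cofinal_map f b k) -> a = b \/ a ∈ b.

(* A notion of forcing is a set P, an order le (a set of ordered pairs, with
   (q, p) in le meaning that q is stronger than p) and a maximum one. *)

Definition compatible P le p q : Prop :=
  exists r, r ∈ P /\ pair_in r p le /\ pair_in r q le.

Record notion_of_forcing P le one : Prop := {
  forcing_le_on : forall z, z ∈ le ->
    exists q p, q ∈ P /\ p ∈ P /\ is_pair q p z;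
  forcing_refl : forall p, p ∈ P -> pair_in p p le;
  forcing_trans : forall p q r,
    pair_in p q le -> pair_in q r le -> pair_in p r le;
  forcing_antisym : forall p q, pair_in p q le -> pair_in q p le -> p = q;
  forcing_one_in : one ∈ P;
  forcing_one_max : forall p, p ∈ P -> pair_in p one le;
  forcing_separative : forall p p', p ∈ P -> p' ∈ P -> ~ pair_in p' p le ->
    exists q, pair_in q p' le /\ ~ compatible P le q p
}.

Definition is_dense P le (U : M -> Prop) : Prop :=
  (forall p, U p -> p ∈ P) /\
  (forall p, p ∈ P -> exists q, U q /\ pair_in q p le).

Definition is_open P le (U : M -> Prop) : Prop :=
  (forall p, U p -> p ∈ P) /\
  (forall p q, U p -> pair_in q p le -> U q).

Definition open_dense P le (U : M -> Prop) : Prop :=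
  is_open P le U /\ is_dense P le U.

(* The sequence <D_α | α < k> is an element D of M.  The intersection is taken
   inside P, so that it is P when k = 0. *)
Definition descending_distributive P le k : Prop :=
  forall D, function_on D k ->
    (forall a d, pair_in a d D -> open_dense P le (fun p => p ∈ d)) ->
    (forall a b d d', a ∈ b -> pair_in a d D -> pair_in b d' D ->
       subset d' d) ->
    open_dense P le (fun p => p ∈ P /\ forall a d, pair_in a d D -> p ∈ d).

(* G is an external subset of P; genericity is over the dense sets in M. *)
Record generic P le (G : M -> Prop) : Prop := {
  generic_sub : forall p, G p -> p ∈ P;
  generic_nonempty : exists p, G p;
  generic_up : forall p q, G p -> pair_in p q le -> G q;
  generic_directed : forall p q, G p -> G q ->
    exists r, G r /\ pair_in r p le /\ pair_in r q le;
  generic_meets : forall D, is_dense P le (fun p => p ∈ D) ->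
    exists p, p ∈ D /\ G p
}.

Definition hereditarily_names P D : Prop :=
  forall s, s ∈ D -> forall z, z ∈ s ->
    exists r p, r ∈ D /\ p ∈ P /\ is_pair r p z.

Definition is_name P t : Prop := exists D, t ∈ D /\ hereditarily_names P D.

(* w is the value of the name t by g, where
     value s = { value r | (r, p) ∈ s for some p ∈ g };
   the recursion is carried out inside M, by a set function f defined on a set
   D of names. *)
Definition name_value P g t w : Prop :=
  exists D f, t ∈ D /\ hereditarily_names P D /\ function_on f D /\
    (forall s v, pair_in s v f -> forall y,
       y ∈ v <-> exists r p, pair_in r p s /\ p ∈ g /\ pair_in r y f) /\
    pair_in t w f.

End Internal.

(* W, with j as the inclusion of V, is V[G].  This determines (W, j) up to
   isomorphism over V: V need not be well-founded in the metatheory, so the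
   evaluation of names is the one computed in W. *)
Record generic_extension (V : structure) (P : V) (G : V -> Prop)
    (W : structure) (j : V -> W) : Prop := {
  ext_ZF : ZF W;
  ext_inj : forall x y, j x = j y -> x = y;
  ext_mem : forall x y, j x ∈ j y <-> x ∈ y;
  ext_transitive : forall x w, w ∈ j x -> exists y, w = j y;
  ext_names : exists g : W,
    (forall w, w ∈ g <-> exists p, G p /\ w = j p) /\
    (forall w, exists t, is_name P t /\ name_value (j P) g (j t) w)
}.

Definition preserves_cofinality (V : structure) (P le k : V) : Prop :=
  forall G : V -> Prop, generic P le G ->
  forall (W : structure) (j : V -> W), generic_extension P G j ->
  exists a : V, is_cofinality k a /\ is_cofinality (j k) (j a).

(* Main.v *)
From Stdlib Require Import Classical PeanoNat.
Require Import Defs.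
Local Open Scope zf_scope.

(** Let a = cf(k), computed in V, and suppose that the extension W has a map f
    from some b < a cofinally into k.  Let N be a nice name of f, that is, a
    relation N(p, n, c) in V, closed under strengthening p, such that
    f(n) = c iff N(p, n, c) for some p in the generic filter G.  For α < k let
      A_α = { p | N(p, n, c) for some n < b and some c ≥ α, c < k },
      D_α = A_α ∪ { p | for some α' < k, no q ≤ p lies in A_α' }.
    The second part of D_α does not depend on α, so the D_α decrease; they are
    open, and dense because a condition without extensions in A_α lies in D_α.
    This is the only place where a sequence of length k of dense sets is met,
    and there it is decreasing, so descending distributivity gives a p in G
    lying in all D_α.  Since f is cofinal, p has, for each α', an extension in
    A_α', so p lies in every A_α.  Thus { (n, c) | N(p, n, c) } is a set in V;
    it is a partial function because it is contained in f, and p ∈ ⋂ A_α says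
    that its range is cofinal in k.  Hence cf(k) ≤ b in V, a contradiction.

    The nice name comes from the forcing theorem, which is needed only for
    formulas r = x with r a name and x in V (truth_lemma, nice_name).  Forcing
    such an equation is monotone in its recursive calls, so the relation can be
    taken as a greatest fixed point inside V, with no recursion along the names
    (forcing_relation_exists); well-foundedness enters only when truth is
    compared with forcing, and that induction is carried out in W, where the
    generic filter and the evaluation of names are available as sets.

    The models need not be well-founded and Separation is a first-order schema,
    so each set that is formed requires a formula; the closure properties of
    definable relations produce it. *)

(** * Definability with parameters *)

(** The environment e with the variables redirected by t, either to a variable
    or to a fixed parameter. *)
Definition look {M : structure} (t : nat -> nat + M) (e : nat -> M) : nat -> M :=
  fun n => match t n with inl i => e i | inr c => c end.

(** Parameters are recorded in t rather than in the formula, so that predicates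
    may mention elements of M freely and no list of parameters is kept. *)
Definition definable {M : structure} (R : (nat -> M) -> Prop) : Prop :=
  exists A t, forall e, sat (look t e) A <-> R e.

Definition simple_term {M : structure} (s : (nat -> M) -> M) : Prop :=
  exists u : nat + M, forall e, s e = match u with inl i => e i | inr c => c end.

Definition up (r : nat -> nat) (n : nat) : nat :=
  match n with O => O | S m => S (r m) end.

Fixpoint rename (r : nat -> nat) (A : formula) : formula :=
  match A with
  | fMem i k => fMem (r i) (r k)
  | fEq i k => fEq (r i) (r k)
  | fBot => fBot
  | fImp A B => fImp (rename r A) (rename r B)
  | fAnd A B => fAnd (rename r A) (rename r B)
  | fOr A B => fOr (rename r A) (rename r B)
  | fAll A => fAll (rename (up r) A)
  | fEx A => fEx (rename (up r) A)
  end.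

Lemma sat_rename {M : structure} (A : formula) :
  forall (r : nat -> nat) (e e' : nat -> M),
    (forall n, e' n = e (r n)) -> (sat e (rename r A) <-> sat e' A).
Proof.
  induction A; intros r e e' H; simpl.
  1, 2: rewrite !H; reflexivity.
  1: reflexivity.
  1, 2, 3: rewrite (IHA1 r e e' H), (IHA2 r e e' H); reflexivity.
  - split; intros HA x; specialize (HA x);
      apply (IHA (up r) (push x e) (push x e')); auto; intros [|n]; simpl; auto.
  - split; intros [x HA]; exists x;
      apply (IHA (up r) (push x e) (push x e')); auto; intros [|n]; simpl; auto.
Qed.

(** Several positions of the formula may be redirected to the variable 0; they
    are merged into position 0, so that one quantifier, or one instance of the
    Separation schema, binds them all. *)
Lemma definable_push {M : structure} (R : (nat -> M) -> Prop) :
  definable R ->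
  exists A t, forall x e, sat (push x (look t e)) A <-> R (push x e).
Proof.
  intros (A & t & H).
  exists (rename (fun n => match t n with inl O => O | _ => S n end) A).
  exists (fun n => match t n with inl (S i) => inl i | u => u end).
  intros x e. rewrite <- H. apply sat_rename.
  intros n. unfold look. destruct (t n) as [[|i]|c] eqn:E; simpl;
    try rewrite E; reflexivity.
Qed.

(** The two formulas use the even and the odd variables respectively, so that
    their redirections can be merged. *)
Lemma definable_common {M : structure} (R S : (nat -> M) -> Prop) :
  definable R -> definable S ->
  exists A B t, (forall e, sat (look t e) A <-> R e) /\
    (forall e, sat (look t e) B <-> S e).
Proof.
  intros (A & t & HA) (B & u & HB).
  exists (rename (fun n => 2 * n) A), (rename (fun n => 2 * n + 1) B).
  exists (fun n => if Nat.even n then t (Nat.div2 n) else u (Nat.div2 n)).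
  split; intros e; [rewrite <- HA | rewrite <- HB];
    apply sat_rename; intros n; unfold look.
  - rewrite Nat.even_even, Nat.div2_double. reflexivity.
  - rewrite Nat.even_odd, Nat.add_1_r, Nat.div2_succ_double. reflexivity.
Qed.

Section Closure.
Context {M : structure}.
Implicit Types (R S : (nat -> M) -> Prop) (s t u : (nat -> M) -> M).

Lemma simple_var i : simple_term (fun e : nat -> M => e i).
Proof. exists (inl i). reflexivity. Qed.

Lemma simple_param (c : M) : simple_term (fun _ => c).
Proof. exists (inr c). reflexivity. Qed.

Lemma definable_mem s t : simple_term s -> simple_term t ->
  definable (fun e => s e ∈ t e).
Proof.
  intros [u Hu] [v Hv]. exists (fMem 0 1), (fun n => match n with O => u | _ => v end).
  intros e. rewrite Hu, Hv. reflexivity.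
Qed.

Lemma definable_eq s t : simple_term s -> simple_term t ->
  definable (fun e => s e = t e).
Proof.
  intros [u Hu] [v Hv]. exists (fEq 0 1), (fun n => match n with O => u | _ => v end).
  intros e. rewrite Hu, Hv. reflexivity.
Qed.

Lemma definable_and R S : definable R -> definable S ->
  definable (fun e => R e /\ S e).
Proof.
  intros HR HS. destruct (definable_common R S HR HS) as (A & B & t & HA & HB).
  exists (fAnd A B), t. intros e. simpl. rewrite HA, HB. reflexivity.
Qed.

Lemma definable_or R S : definable R -> definable S ->
  definable (fun e => R e \/ S e).
Proof.
  intros HR HS. destruct (definable_common R S HR HS) as (A & B & t & HA & HB).
  exists (fOr A B), t. intros e. simpl. rewrite HA, HB. reflexivity.
Qed.

Lemma definable_imp R S : definable R -> definable S ->
  definable (fun e => R e -> S e).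
Proof.
  intros HR HS. destruct (definable_common R S HR HS) as (A & B & t & HA & HB).
  exists (fImp A B), t. intros e. simpl. rewrite HA, HB. reflexivity.
Qed.

Lemma definable_iff R S : definable R -> definable S ->
  definable (fun e => R e <-> S e).
Proof. intros HR HS. apply definable_and; apply definable_imp; assumption. Qed.

Lemma definable_not R : definable R -> definable (fun e => ~ R e).
Proof.
  intros (A & t & HA). exists (fImp A fBot), t. intros e. simpl. rewrite HA. reflexivity.
Qed.

Lemma definable_all (R : M -> (nat -> M) -> Prop) :
  definable (fun e => R (e 0) (fun n => e (S n))) ->
  definable (fun e => forall x, R x e).
Proof.
  intros H. destruct (definable_push _ H) as (A & t & HA).
  exists (fAll A), t. intros e. simpl.
  split; intros Hx x; apply (HA x e); apply Hx.
Qed.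

Lemma definable_ex (R : M -> (nat -> M) -> Prop) :
  definable (fun e => R (e 0) (fun n => e (S n))) ->
  definable (fun e => exists x, R x e).
Proof.
  intros H. destruct (definable_push _ H) as (A & t & HA).
  exists (fEx A), t. intros e. simpl.
  split; intros [x Hx]; exists x; apply (HA x e); apply Hx.
Qed.

End Closure.

Create HintDb set_theory.
#[global] Hint Unfold subset is_upair is_pair pair_in function_on function_to cofinal_map
  unique : set_theory.

Ltac definability :=
  repeat autounfold with set_theory; cbv beta;
  repeat (first
    [ apply definable_mem; first [apply simple_var | apply simple_param]
    | apply definable_eq; first [apply simple_var | apply simple_param]
    | apply definable_and | apply definable_or | apply definable_iff
    | apply definable_not | apply definable_imp
    | apply definable_all | apply definable_ex ]; cbv beta).

(** * Set theory inside a model of ZF *)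

Section SetTheory.
Context {M : structure} (hM : ZF M).
Implicit Types (a b c f k p q r x y z A B C D : M).

Lemma separation (phi : M -> Prop) a :
  definable (fun e => phi (e 0)) ->
  exists b, forall x, x ∈ b <-> x ∈ a /\ phi x.
Proof.
  intros H. destruct (definable_push _ H) as (A & t & HA).
  destruct (zf_separation hM A (look t (fun _ => a)) a) as [b Hb].
  exists b. intros x. rewrite Hb. rewrite (HA x (fun _ => a)). reflexivity.
Qed.

Lemma upair_exists x y : exists z, is_upair x y z.
Proof. destruct (zf_pairing hM x y) as [c Hc]. exists c. exact Hc. Qed.

Lemma upair_unique x y z z' : is_upair x y z -> is_upair x y z' -> z = z'.
Proof.
  intros H H'. apply (zf_extensionality hM). intros w. rewrite (H w), (H' w). reflexivity.
Qed.

Lemma pair_exists x y : exists z, is_pair x y z.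
Proof.
  destruct (upair_exists x x) as [a Ha]. destruct (upair_exists x y) as [b Hb].
  destruct (upair_exists a b) as [c Hc]. exists c, a, b. auto.
Qed.

Lemma pair_unique x y z z' : is_pair x y z -> is_pair x y z' -> z = z'.
Proof.
  intros (a & b & Ha & Hb & H) (a' & b' & Ha' & Hb' & H').
  rewrite (upair_unique _ _ _ _ Ha' Ha), (upair_unique _ _ _ _ Hb' Hb) in H'.
  exact (upair_unique _ _ _ _ H H').
Qed.

Lemma upair_inj x y x' y' z : is_upair x y z -> is_upair x' y' z ->
  (x = x' /\ y = y') \/ (x = y' /\ y = x').
Proof.
  intros H H'.
  assert (E : forall w, w = x \/ w = y <-> w = x' \/ w = y')
    by (intros w; rewrite <- (H w), <- (H' w); reflexivity).
  pose proof (proj1 (E x) (or_introl eq_refl)).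
  pose proof (proj1 (E y) (or_intror eq_refl)).
  pose proof (proj2 (E x') (or_introl eq_refl)).
  pose proof (proj2 (E y') (or_intror eq_refl)).
  intuition congruence.
Qed.

Lemma pair_inj x y x' y' z : is_pair x y z -> is_pair x' y' z -> x = x' /\ y = y'.
Proof.
  intros (a & b & Ha & Hb & H) (a' & b' & Ha' & Hb' & H').
  destruct (upair_inj _ _ _ _ _ H H') as [[-> ->] | [-> ->]].
  - pose proof (upair_inj _ _ _ _ _ Ha Ha').
    pose proof (upair_inj _ _ _ _ _ Hb Hb'). intuition congruence.
  - pose proof (upair_inj _ _ _ _ _ Ha Hb').
    pose proof (upair_inj _ _ _ _ _ Hb Ha'). intuition congruence.
Qed.

Lemma pair_in_iff x y z r : is_pair x y z -> (pair_in x y r <-> z ∈ r).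
Proof.
  intros H. split.
  - intros (z' & H' & Hz'). rewrite (pair_unique _ _ _ _ H H'). exact Hz'.
  - intros Hz. exists z. auto.
Qed.

Lemma union2 a b : exists c, forall x, x ∈ c <-> x ∈ a \/ x ∈ b.
Proof.
  destruct (upair_exists a b) as [p Hp]. destruct (zf_union hM p) as [c Hc].
  exists c. intros x. rewrite Hc. split.
  - intros (y & Hy & Hx). apply Hp in Hy. destruct Hy as [-> | ->]; auto.
  - intros [Hx | Hx]; [exists a | exists b]; split; auto; apply Hp; auto.
Qed.

(** {x} and {x, y} are subsets of A ∪ B when x ∈ A and y ∈ B, so the
    pair lies two power sets above A ∪ B. *)
Lemma pairs_bounded A B :
  exists C, forall x y z, x ∈ A -> y ∈ B -> is_pair x y z -> z ∈ C.
Proof.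
  destruct (union2 A B) as [U HU]. destruct (zf_powerset hM U) as [Q HQ].
  destruct (zf_powerset hM Q) as [C HC]. exists C.
  intros x y z Hx Hy (a & b & Ha & Hb & Hz). apply HC. intros c Hc. apply HQ.
  intros w Hw. apply HU. apply Hz in Hc. destruct Hc as [-> | ->].
  - apply Ha in Hw. destruct Hw; subst; auto.
  - apply Hb in Hw. destruct Hw; subst; auto.
Qed.

Lemma relation_comprehension (phi : M -> M -> Prop) A B :
  definable (fun e => phi (e 0) (e 1)) ->
  exists r, (forall z, z ∈ r -> exists x y, x ∈ A /\ y ∈ B /\ is_pair x y z) /\
    forall x y, pair_in x y r <-> x ∈ A /\ y ∈ B /\ phi x y.
Proof.
  intros H. destruct (pairs_bounded A B) as [C HC].
  destruct (separation (fun z => exists y x, x ∈ A /\ y ∈ B /\ is_pair x y z /\ phi x y) C)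
    as [r Hr].
  { do 2 apply definable_ex. cbv beta.
    repeat apply definable_and; [definability | definability | definability | exact H]. }
  exists r. split.
  - intros z Hz. apply Hr in Hz. destruct Hz as (_ & y & x & Hx & Hy & Hz & _).
    exists x, y. auto.
  - intros x y. split.
    + intros (z & Hz & Hzr). apply Hr in Hzr.
      destruct Hzr as (_ & y' & x' & Hx & Hy & Hz' & Hphi).
      destruct (pair_inj _ _ _ _ _ Hz Hz') as [-> ->]. auto.
    + intros (Hx & Hy & Hphi). destruct (pair_exists x y) as [z Hz].
      exists z. split; auto. apply Hr. split; [eauto | exists y, x; auto].
Qed.

(** ** Ordinals and cofinalities *)

Lemma least_element A a B : ordinal A -> subset B A -> a ∈ B ->
  exists x, x ∈ B /\ forall y, y ∈ B -> x = y \/ x ∈ y.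
Proof. intros (_ & _ & _ & _ & Hwf) HB Ha. apply Hwf; [exact HB | eauto]. Qed.

Lemma ordinal_trans a x y : ordinal a -> x ∈ y -> y ∈ a -> x ∈ a.
Proof. intros [Ht _] Hx Hy. exact (Ht y Hy x Hx). Qed.

Lemma ordinal_elem_trans a x y z : ordinal a -> x ∈ y -> y ∈ z -> z ∈ a -> x ∈ z.
Proof.
  intros Ha Hx Hy Hz.
  assert (y ∈ a) by eauto using ordinal_trans.
  assert (x ∈ a) by eauto using ordinal_trans.
  destruct Ha as (_ & _ & Htr & _). eauto.
Qed.

Lemma ordinal_elem a b : ordinal a -> b ∈ a -> ordinal b.
Proof.
  intros Ha Hb. split.
  - intros y Hy x Hx. exact (ordinal_elem_trans a x y b Ha Hx Hy Hb).
  - assert (Hs : subset b a) by (intros x Hx; eauto using ordinal_trans).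
    destruct Ha as (_ & Hirr & Htr & Htot & Hwf). repeat split; eauto.
    intros c Hc. apply Hwf. intros x Hx. auto.
Qed.

(** The least element x of a missing from c has all its elements in c, and no
    element of c is above x because c is transitive; so c = x. *)
Lemma ordinal_initial a c : ordinal a -> subset c a -> transitive c -> c = a \/ c ∈ a.
Proof.
  intros Ha Hca Hc. destruct (classic (exists x, x ∈ a /\ ~ x ∈ c)) as [[x0 Hx0] | Hn].
  2: { left. apply (zf_extensionality hM). intros x. split; [apply Hca |].
       intros Hx. apply NNPP. intros Hxc. eauto. }
  right. destruct (separation (fun x => ~ x ∈ c) a) as [d Hd]; [definability |].
  destruct (least_element a x0 d Ha) as (x & Hx & Hmin).
  { intros y Hy. apply Hd in Hy. tauto. }
  { apply Hd. exact Hx0. }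
  apply Hd in Hx. destruct Hx as [Hxa Hxc].
  replace c with x; [exact Hxa |].
  pose proof Ha as (_ & Hirr & _ & Htot & _).
  apply (zf_extensionality hM). intros y. split.
  - intros Hy. apply NNPP. intros Hyc.
    assert (Hya : y ∈ a) by eauto using ordinal_trans.
    destruct (Hmin y) as [-> | Hxy]; [apply Hd; auto | exact (Hirr y Hya Hy) |].
    exact (Hirr x Hxa (ordinal_elem_trans a x y x Ha Hxy Hy Hxa)).
  - intros Hy. destruct (Htot x y Hxa (Hca y Hy)) as [Hxy | [-> | Hyx]]; auto.
    + destruct Hxc. exact (Hc y Hy x Hxy).
    + contradiction.
Qed.

Lemma ordinal_trichotomy a b : ordinal a -> ordinal b -> a ∈ b \/ a = b \/ b ∈ a.
Proof.
  intros Ha Hb. destruct (separation (fun x => x ∈ b) a) as [c Hc]; [definability |].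
  assert (Hct : transitive c).
  { intros x Hx y Hy. apply Hc in Hx. apply Hc. destruct Hx. eauto using ordinal_trans. }
  assert (Hca : subset c a) by (intros x Hx; apply Hc in Hx; tauto).
  assert (Hcb : subset c b) by (intros x Hx; apply Hc in Hx; tauto).
  destruct (ordinal_initial a c Ha Hca Hct) as [Ea | Ha'];
    destruct (ordinal_initial b c Hb Hcb Hct) as [Eb | Hb'].
  1, 2, 3: subst; auto.
  destruct Ha as (_ & Hirr & _). destruct (Hirr c Ha'). apply Hc. auto.
Qed.

Lemma identity_cofinal k : exists f, cofinal_map f k k.
Proof.
  destruct (relation_comprehension (fun x y => x = y) k k) as (f & Hf & Hin);
    [definability |].
  exists f. split; [split; [split |] |].
  - intros z Hz. destruct (Hf z Hz) as (x & y & Hx & _ & Hz'). eauto.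
  - intros x Hx. exists x. split; [apply Hin; auto |].
    intros y Hy. apply Hin in Hy. tauto.
  - intros x y Hxy. apply Hin in Hxy. tauto.
  - intros x Hx. exists x, x. split; [apply Hin |]; auto.
Qed.

(** The identity maps k cofinally into itself, so the least ordinal in question
    is either k or the least one below k. *)
Lemma cofinality_exists k : ordinal k -> exists a, is_cofinality k a.
Proof.
  intros Hk. destruct (classic (exists b f, b ∈ k /\ cofinal_map f b k))
    as [(b0 & f0 & Hb0 & Hf0) | Hn].
  - destruct (separation (fun b => exists f, cofinal_map f b k) k) as [B HB];
      [definability |].
    destruct (least_element k b0 B Hk) as (a & Ha & Hmin).
    { intros x Hx. apply HB in Hx. tauto. }
    { apply HB. eauto. }
    apply HB in Ha. destruct Ha as [Hak Hfa]. exists a. split; [| split; [exact Hfa |]].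
    { eauto using ordinal_elem. }
    intros b Hb Hf. destruct (ordinal_trichotomy b k Hb Hk) as [Hbk | [-> | Hkb]].
    + apply Hmin. apply HB. auto.
    + auto.
    + right. eauto using ordinal_trans.
  - exists k. split; [exact Hk | split; [apply identity_cofinal |]].
    intros b Hb [f Hf]. destruct (ordinal_trichotomy b k Hb Hk) as [H | [H | H]]; auto.
    destruct Hn. eauto.
Qed.

(** Passing from a name to a name occurring in it goes down three steps of
    membership, since r ∈ {r} ∈ (r, p) ∈ s.  Foundation is therefore applied to
    B enlarged by the sets at the levels of {r} and of (r, p) from which an
    element of B is reached in one, respectively two, further steps. *)
Lemma minimal_name B :
  (exists s, s ∈ B) ->
  exists s, s ∈ B /\ forall r p, pair_in r p s -> ~ r ∈ B.
Proof.
  intros [s0 Hs0].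
  destruct (zf_union hM B) as [B1 HB1]. destruct (zf_union hM B1) as [B2 HB2].
  destruct (union2 B B1) as [Z0 HZ0]. destruct (union2 Z0 B2) as [Z HZ].
  destruct (separation (fun u => u ∈ B \/ (u ∈ B2 /\ exists r, r ∈ B /\ r ∈ u) \/
    (u ∈ B1 /\ exists v r, r ∈ B /\ r ∈ v /\ v ∈ u)) Z) as [C' HC']; [definability |].
  (* The bounds B1 and B2 on the intermediate levels make u ∈ Z automatic. *)
  assert (HC : forall u, u ∈ C' <-> u ∈ B \/ (u ∈ B2 /\ exists r, r ∈ B /\ r ∈ u) \/
    (u ∈ B1 /\ exists v r, r ∈ B /\ r ∈ v /\ v ∈ u)).
  { intros u. rewrite HC', HZ, HZ0. tauto. }
  destruct (zf_foundation hM (a := C')) as (m & HmC & Hm).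
  { exists s0. apply HC. auto. }
  assert (Hlow : forall u, u ∈ m -> ~ u ∈ C') by (intros u Hu Hu'; eauto).
  apply HC in HmC.
  destruct HmC as [HmB | [(_ & r & Hr & Hrm) | (HmB1 & v & r & Hr & Hrv & Hvm)]].
  - exists m. split; [exact HmB |]. intros r p (z & (a & b & Ha & Hb & Hz) & Hzm) Hr.
    apply (Hlow z Hzm). apply HC. right. right.
    split; [apply HB1; eauto |]. exists a, r.
    repeat split; [exact Hr | apply Ha; auto | apply Hz; auto].
  - destruct (Hlow r Hrm). apply HC. auto.
  - destruct (Hlow v Hvm). apply HC. right. left. split; [apply HB2; eauto | eauto].
Qed.

End SetTheory.

(** * The forcing relation for equality with ground model sets *)

Definition triple_in {M : structure} (p r x F : M) : Prop :=
  exists w, is_pair r x w /\ pair_in p w F.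

(** One unfolding of p ⊩ r = x, with F in place of the recursive calls: densely
    often, each potential element of r is forced to equal some element of x,
    and each element of x is forced to equal an actual element of r. *)
Definition forcing_step {M : structure} (le F p r x : M) : Prop :=
  (forall r' s q, pair_in r' s r -> pair_in q p le -> pair_in q s le ->
     exists q' y, pair_in q' q le /\ y ∈ x /\ triple_in q' r' y F) /\
  (forall y q, y ∈ x -> pair_in q p le ->
     exists q' r' s, pair_in q' q le /\ pair_in r' s r /\ pair_in q' s le /\
       triple_in q' r' y F).

#[global] Hint Unfold triple_in forcing_step : set_theory.

Lemma forcing_step_mono {M : structure} (le F F' p r x : M) :
  (forall q s y, triple_in q s y F -> triple_in q s y F') ->
  forcing_step le F p r x -> forcing_step le F' p r x.
Proof.
  intros H [H1 H2]. split.
  - intros r' s q Hr Hq Hs. destruct (H1 r' s q Hr Hq Hs) as (q' & y & ? & ? & ?).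
    exists q', y. auto.
  - intros y q Hy Hq. destruct (H2 y q Hy Hq) as (q' & r' & s & ? & ? & ? & ?).
    exists q', r', s. auto.
Qed.

(** The step is monotone in F, so its greatest fixed point is the union of all
    sets X of triples with X contained in step(X) (Knaster and Tarski).  This
    union is a set since all triples lie in one bounding set. *)
Lemma forcing_relation_exists {M : structure} (hM : ZF M) (P le D T : M) :
  exists F, forall p r x, triple_in p r x F <->
    p ∈ P /\ r ∈ D /\ x ∈ T /\ forcing_step le F p r x.
Proof.
  destruct (pairs_bounded hM D T) as [C HC].
  destruct (relation_comprehension hM (fun p w => exists X, pair_in p w X /\
     forall p r x, triple_in p r x X ->
       p ∈ P /\ r ∈ D /\ x ∈ T /\ forcing_step le X p r x) P C) as (F & _ & HF);
    [definability |].
  exists F.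
  assert (Hincl : forall X, (forall p r x, triple_in p r x X ->
       p ∈ P /\ r ∈ D /\ x ∈ T /\ forcing_step le X p r x) ->
     forall p r x, triple_in p r x X -> triple_in p r x F).
  { intros X HX p r x Hp. destruct (HX p r x Hp) as (HpP & Hr & Hx & _).
    destruct Hp as (w & Hw & Hp). exists w. split; [exact Hw |].
    apply HF. split; [exact HpP |]. split; [exact (HC r x w Hr Hx Hw) |].
    exists X. auto. }
  assert (Hpost : forall p r x, triple_in p r x F ->
    p ∈ P /\ r ∈ D /\ x ∈ T /\ forcing_step le F p r x).
  { intros p r x (w & Hw & Hp). apply HF in Hp. destruct Hp as (_ & _ & X & Hp & HX).
    destruct (HX p r x) as (H1 & H2 & H3 & H4); [exists w; auto |].
    repeat split; auto; eapply (forcing_step_mono le X); eauto. }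
  intros p r x. split; [apply Hpost |]. intros (Hp & Hr & Hx & Hstep).
  destruct (pair_exists hM r x) as [w Hw]. destruct (pair_exists hM p w) as [z Hz].
  destruct (upair_exists hM z z) as [S HS]. destruct (union2 hM F S) as [X HX].
  assert (HFX : forall q s y, triple_in q s y F -> triple_in q s y X).
  { intros q s y (v & Hv & u & Hu & HuF). exists v. split; [exact Hv |].
    exists u. split; [exact Hu |]. apply HX. auto. }
  (* Adding one triple that satisfies the step keeps F a post-fixed point. *)
  apply (Hincl X).
  - intros q s y (v & Hv & u & Hu & HuX). apply HX in HuX.
    destruct HuX as [HuF | HuS].
    + destruct (Hpost q s y) as (H1 & H2 & H3 & H4); [exists v; split; [| exists u]; auto |].
      repeat split; auto; eapply (forcing_step_mono le F); eauto.
    + assert (u = z) as -> by (apply HS in HuS; tauto).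
      destruct (pair_inj _ _ _ _ _ Hu Hz) as [-> ->].
      destruct (pair_inj _ _ _ _ _ Hv Hw) as [-> ->].
      repeat split; auto; eapply (forcing_step_mono le F); eauto.
  - exists w. split; [exact Hw |]. exists z. split; [exact Hz |].
    apply HX. right. apply HS. auto.
Qed.

Section Generic.
Context {V : structure} (hV : ZF V) (P le one : V) (hP : notion_of_forcing P le one).
Context (G : V -> Prop) (hG : generic P le G).

Lemma le_in q p : pair_in q p le -> q ∈ P /\ p ∈ P.
Proof.
  intros (z & Hz & Hzle). destruct (forcing_le_on hP Hzle) as (q' & p' & Hq & Hp & Hz').
  destruct (pair_inj _ _ _ _ _ Hz Hz') as [-> ->]. auto.
Qed.

(** The conditions incompatible with p, added to phi, make it dense everywhere;
    the generic filter contains p, so it meets phi itself. *)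
Lemma generic_meets_below (phi : V -> Prop) p :
  definable (fun e => phi (e 0)) -> G p ->
  (forall q, pair_in q p le -> exists q', pair_in q' q le /\ phi q') ->
  exists q, G q /\ phi q.
Proof.
  intros Hdef Hp Hdense.
  destruct (separation hV (fun q => phi q \/
     ~ exists r, pair_in r q le /\ pair_in r p le) P) as [U HU].
  { apply definable_or; [exact Hdef | definability]. }
  destruct (generic_meets hG (D := U)) as (q & HqU & Hq).
  - split; [intros q Hq; apply HU in Hq; tauto |].
    intros u Hu. destruct (classic (exists r, pair_in r u le /\ pair_in r p le))
      as [(r & Hru & Hrp) | Hn].
    + destruct (Hdense r Hrp) as (q & Hqr & Hq). exists q. split.
      * apply HU. split; [apply (le_in q r Hqr) | auto].
      * eapply (forcing_trans hP); eauto.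
    + exists u. split; [apply HU; auto | apply (forcing_refl hP Hu)].
  - exists q. split; [exact Hq |]. apply HU in HqU. destruct HqU as [_ [? | Hn]]; auto.
    destruct Hn. destruct (generic_directed hG Hq Hp) as (r & _ & Hr). eauto.
Qed.

End Generic.

(** * Transitive embeddings *)

(** A pair that is a member of j r, and both its components, come from V, so
    notions built from pairs by bounded quantification are absolute. *)

Section Embedding.
Context {V W : structure} (j : V -> W).
Context (j_inj : forall x y, j x = j y -> x = y).
Context (j_mem : forall x y, j x ∈ j y <-> x ∈ y).
Context (j_trans : forall x w, w ∈ j x -> exists y, w = j y).

Lemma upair_abs x y z : is_upair (j x) (j y) (j z) <-> is_upair x y z.
Proof.
  split; intros H w.
  - rewrite <- j_mem, (H (j w)). split; intros [E | E]; subst; auto.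
  - split.
    + intros Hw. destruct (j_trans z w Hw) as [u ->]. apply j_mem in Hw.
      apply H in Hw. destruct Hw; subst; auto.
    + intros [-> | ->]; apply j_mem; apply H; auto.
Qed.

Lemma pair_abs x y z : is_pair (j x) (j y) (j z) <-> is_pair x y z.
Proof.
  split.
  - intros (a & b & Ha & Hb & Hz).
    destruct (j_trans z a) as [a' ->]; [apply Hz; auto |].
    destruct (j_trans z b) as [b' ->]; [apply Hz; auto |].
    exists a', b'. repeat split; apply upair_abs; assumption.
  - intros (a & b & Ha & Hb & Hz). exists (j a), (j b).
    repeat split; apply upair_abs; assumption.
Qed.

Lemma pair_components u v z : is_pair u v (j z) -> exists x y, u = j x /\ v = j y.
Proof.
  intros (a & b & Ha & Hb & Hz).
  destruct (j_trans z b) as [b' ->]; [apply Hz; auto |].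
  destruct (j_trans b' u) as [x Hx]; [apply Hb; auto |].
  destruct (j_trans b' v) as [y Hy]; [apply Hb; auto |]. eauto.
Qed.

Lemma pair_in_abs x y r : pair_in (j x) (j y) (j r) <-> pair_in x y r.
Proof.
  split.
  - intros (z & Hz & Hzr). destruct (j_trans r z Hzr) as [z' ->].
    exists z'. split; [apply pair_abs | apply j_mem]; assumption.
  - intros (z & Hz & Hzr). exists (j z). split; [apply pair_abs | apply j_mem]; assumption.
Qed.

Lemma pair_in_components u v r :
  pair_in u v (j r) -> exists x y, u = j x /\ v = j y /\ pair_in x y r.
Proof.
  intros (z & Hz & Hzr). destruct (j_trans r z Hzr) as [z' ->].
  destruct (pair_components u v z' Hz) as (x & y & -> & ->).
  exists x, y. repeat split. apply pair_in_abs. exists (j z'). auto.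
Qed.

Lemma triple_in_abs p r x F : triple_in (j p) (j r) (j x) (j F) <-> triple_in p r x F.
Proof.
  split.
  - intros (w & Hw & Hp). destruct (pair_in_components _ _ _ Hp) as (p' & w' & Ep & -> & Hp').
    apply j_inj in Ep. subst. exists w'. split; [apply pair_abs |]; assumption.
  - intros (w & Hw & Hp). exists (j w). split; [apply pair_abs | apply pair_in_abs]; assumption.
Qed.

Lemma function_to_abs f a b : function_to f a b -> function_to (j f) (j a) (j b).
Proof.
  intros [[Hf Hfun] Hb]. split; [split |].
  - intros z Hz. destruct (j_trans f z Hz) as [z' ->]. apply j_mem in Hz.
    destruct (Hf z' Hz) as (x & y & Hx & Hxy). exists (j x), (j y).
    split; [apply j_mem | apply pair_abs]; assumption.
  - intros x Hx. destruct (j_trans a x Hx) as [x' ->]. apply j_mem in Hx.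
    destruct (Hfun x' Hx) as (y & Hy & Huniq). exists (j y).
    split; [apply pair_in_abs; exact Hy |]. intros w Hw.
    destruct (pair_in_components _ _ _ Hw) as (x & y' & Ex & -> & Hy').
    apply j_inj in Ex. subst. rewrite (Huniq y' Hy'). reflexivity.
  - intros x y Hxy. destruct (pair_in_components _ _ _ Hxy) as (x' & y' & -> & -> & H).
    apply j_mem. eauto.
Qed.

Lemma cofinal_map_abs f a k : cofinal_map f a k -> cofinal_map (j f) (j a) (j k).
Proof.
  intros [Hf Hcof]. split; [apply function_to_abs; exact Hf |].
  intros x Hx. destruct (j_trans k x Hx) as [x' ->]. apply j_mem in Hx.
  destruct (Hcof x' Hx) as (b & y & Hby & Hxy). exists (j b), (j y).
  split; [apply pair_in_abs; exact Hby |].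
  destruct Hxy as [-> | Hxy]; [auto | right; apply j_mem; exact Hxy].
Qed.

Lemma ordinal_abs a : ZF W -> ordinal a -> ordinal (j a).
Proof.
  intros hW (Ht & Hirr & Htr & Htot & _).
  assert (Hel : forall w, w ∈ j a -> exists x, w = j x /\ x ∈ a).
  { intros w Hw. destruct (j_trans a w Hw) as [x ->]. exists x. split; auto.
    apply j_mem. exact Hw. }
  split; [| split; [| split; [| split]]].
  - intros x Hx y Hy. destruct (Hel x Hx) as (x' & -> & Hx').
    destruct (j_trans x' y Hy) as [y' ->]. apply j_mem. apply j_mem in Hy.
    exact (Ht x' Hx' y' Hy).
  - intros x Hx. destruct (Hel x Hx) as (x' & -> & Hx'). rewrite j_mem. auto.
  - intros x y z Hx Hy Hz. destruct (Hel x Hx) as (x' & -> & Hx').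
    destruct (Hel y Hy) as (y' & -> & Hy'). destruct (Hel z Hz) as (z' & -> & Hz').
    rewrite !j_mem. eauto.
  - intros x y Hx Hy. destruct (Hel x Hx) as (x' & -> & Hx').
    destruct (Hel y Hy) as (y' & -> & Hy'). rewrite !j_mem.
    destruct (Htot x' y' Hx' Hy') as [? | [-> | ?]]; auto.
  - (* A subset of j a in W need not come from V: its least element is given
       by foundation in W. *)
    intros b Hb Hne. destruct (zf_foundation hW Hne) as (x & Hx & Hmin).
    exists x. split; [exact Hx |]. intros y Hy.
    destruct (Hel x (Hb x Hx)) as (x' & -> & Hx').
    destruct (Hel y (Hb y Hy)) as (y' & -> & Hy').
    destruct (Htot x' y' Hx' Hy') as [H | [-> | H]]; auto.
    + right. apply j_mem. exact H.
    + destruct Hmin. exists (j y'). split; [apply j_mem; exact H | exact Hy].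
Qed.

End Embedding.

(** * The truth lemma *)

Lemma name_dom {M : structure} (P D r s p : M) :
  hereditarily_names P D -> s ∈ D -> pair_in r p s -> r ∈ D /\ p ∈ P.
Proof.
  intros HD Hs (z & Hz & Hzs). destruct (HD s Hs z Hzs) as (r' & p' & Hr & Hp & Hz').
  destruct (pair_inj _ _ _ _ _ Hz Hz') as [-> ->]. auto.
Qed.

Section Truth.
Context {V : structure} (hV : ZF V) (P le one : V) (hP : notion_of_forcing P le one).
Context (G : V -> Prop) (hG : generic P le G).
Context {W : structure} (j : V -> W) (hE : generic_extension P G j).
Context (g : W) (hg : forall w, w ∈ g <-> exists p, G p /\ w = j p).
Context (D T F : V) (hD : hereditarily_names P D) (hT : transitive T).
Context (hF : forall p r x, triple_in p r x F <->
  p ∈ P /\ r ∈ D /\ x ∈ T /\ forcing_step le F p r x).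
(* The names are evaluated in W by a function f' on a set D' of names that need
   not come from V. *)
Context (D' f' : W) (hD' : hereditarily_names (j P) D') (hf' : function_on f' D').
Context (hval : forall s v, pair_in s v f' -> forall y,
  y ∈ v <-> exists r p, pair_in r p s /\ p ∈ g /\ pair_in r y f').

Let j_inj := ext_inj hE.
Let j_mem := ext_mem hE.
Let j_trans := ext_transitive hE.

Lemma g_spec p : j p ∈ g <-> G p.
Proof.
  rewrite hg. split.
  - intros (q & Hq & E). apply j_inj in E. subst. exact Hq.
  - intros Hp. exists p. auto.
Qed.

Lemma value_spec s v y : pair_in (j s) v f' ->
  (y ∈ v <-> exists r p, pair_in r p s /\ G p /\ pair_in (j r) y f').
Proof.
  intros Hv. rewrite (hval _ _ Hv y). split.
  - intros (r & p & Hrp & Hp & Hy).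
    destruct (pair_in_components j j_inj j_mem j_trans _ _ _ Hrp) as (r' & p' & -> & -> & H).
    exists r', p'. rewrite <- g_spec. auto.
  - intros (r & p & Hrp & Hp & Hy). exists (j r), (j p).
    rewrite g_spec, (pair_in_abs j j_inj j_mem j_trans). auto.
Qed.

Lemma value_exists s : j s ∈ D' -> exists v, pair_in (j s) v f'.
Proof. intros Hs. destruct (proj2 hf' (j s) Hs) as (v & Hv & _). eauto. Qed.

Lemma forces_open p q r x : triple_in p r x F -> pair_in q p le -> triple_in q r x F.
Proof.
  intros H Hqp. apply hF in H. destruct H as (_ & Hr & Hx & H1 & H2). apply hF.
  split; [apply (le_in P le one hP q p Hqp) |]. repeat split; auto.
  - intros r' s u Hr' Hu. apply H1; auto. exact (forcing_trans hP Hu Hqp).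
  - intros y u Hy Hu. apply H2; auto. exact (forcing_trans hP Hu Hqp).
Qed.

Definition truth_at (r : V) : Prop :=
  forall x v, x ∈ T -> pair_in (j r) v f' ->
    (v = j x <-> exists q, G q /\ triple_in q r x F).

Section Step.
Context (r : V) (Hr : r ∈ D) (HrD' : j r ∈ D').
Context (IH : forall r' s, pair_in r' s r -> truth_at r').
Context (x : V) (v : W) (Hx : x ∈ T) (Hv : pair_in (j r) v f').

Lemma subname r' s : pair_in r' s r -> r' ∈ D /\ s ∈ P /\ j r' ∈ D'.
Proof.
  intros H. destruct (name_dom P D r' r s hD Hr H) as [H1 H2].
  apply (pair_in_abs j j_inj j_mem j_trans) in H.
  destruct (name_dom (j P) D' _ _ _ hD' HrD' H) as [H3 _]. auto.
Qed.

(** By genericity G contains a condition realizing each of the density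
    requirements in the forcing step below q. *)
Lemma truth_sound q : G q -> triple_in q r x F -> v = j x.
Proof.
  intros Hq Hf. apply hF in Hf. destruct Hf as (_ & _ & _ & H1 & H2).
  apply (zf_extensionality (ext_ZF hE)). intros y. split.
  - intros Hy. apply (value_spec _ _ _ Hv) in Hy. destruct Hy as (r' & s & Hrs & Hs & Hy).
    destruct (generic_directed hG Hq Hs) as (q0 & Hq0 & Hq0q & Hq0s).
    destruct (generic_meets_below hV P le one hP G hG
      (fun q' => exists y', y' ∈ x /\ triple_in q' r' y' F) q0)
      as (q1 & Hq1 & y' & Hy' & Hforce).
    + definability.
    + exact Hq0.
    + intros q1 Hq1. destruct (H1 r' s q1 Hrs) as (q' & y' & Hq' & Hy' & Hforce).
      * exact (forcing_trans hP Hq1 Hq0q).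
      * exact (forcing_trans hP Hq1 Hq0s).
      * eauto.
    + assert (y = j y') as ->.
      { apply (IH r' s Hrs y' y); eauto. exact (hT x Hx y' Hy'). }
      apply j_mem. exact Hy'.
  - intros Hy. destruct (j_trans x y Hy) as [y' ->]. apply j_mem in Hy.
    destruct (generic_meets_below hV P le one hP G hG
      (fun q' => exists r' s, pair_in r' s r /\ pair_in q' s le /\ triple_in q' r' y' F) q)
      as (q1 & Hq1 & r' & s & Hrs & Hqs & Hforce).
    + definability.
    + exact Hq.
    + intros q1 Hq1. destruct (H2 y' q1 Hy Hq1) as (q' & r' & s & ? & ? & ? & ?).
      exists q'. split; auto. exists r', s. auto.
    + apply (value_spec _ _ _ Hv). exists r', s. split; [exact Hrs |].
      split; [exact (generic_up hG Hq1 Hqs) |].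
      destruct (value_exists r') as [u Hu]; [apply (subname r' s Hrs) |].
      assert (u = j y') as <-; [| exact Hu].
      apply (IH r' s Hrs y' u); eauto. exact (hT x Hx y' Hy).
Qed.

(** It is dense to force r = x or to refute one of the two inclusions outright.
    A condition of G cannot refute an inclusion that holds in W: the induction
    hypothesis yields a condition of G, compatible with it, forcing the
    opposite. *)
Lemma truth_complete : v = j x -> exists q, G q /\ triple_in q r x F.
Proof.
  intros Evx. apply NNPP. intros Hno.
  destruct (generic_nonempty hG) as [p0 Hp0].
  destruct (generic_meets_below hV P le one hP G hG
    (fun q => triple_in q r x F \/
      (exists r' s, pair_in r' s r /\ pair_in q s le /\
        ~ exists q' y, pair_in q' q le /\ y ∈ x /\ triple_in q' r' y F) \/
      (exists y, y ∈ x /\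
        ~ exists q' r' s, pair_in q' q le /\ pair_in r' s r /\ pair_in q' s le /\
          triple_in q' r' y F)) p0)
    as (q & Hq & [Hf | [(r' & s & Hrs & Hqs & Hn) | (y & Hy & Hn)]]).
  - definability.
  - exact Hp0.
  - intros p Hp. apply NNPP. intros Hp'.
    assert (HpP := proj1 (le_in P le one hP p p0 Hp)).
    apply Hp'. exists p. split; [apply (forcing_refl hP HpP) |]. left. apply hF.
    split; [exact HpP |]. repeat split; auto.
    + intros r' s q Hrs Hqp Hqs. apply NNPP. intros Hn. apply Hp'.
      exists q. split; [exact Hqp |]. right. left. exists r', s. auto.
    + intros y q Hy Hqp. apply NNPP. intros Hn. apply Hp'.
      exists q. split; [exact Hqp |]. right. right. exists y. auto.
  - apply Hno. eauto.
  - destruct (subname r' s Hrs) as (_ & _ & Hr'). destruct (value_exists r' Hr') as [u Hu].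
    assert (Huv : u ∈ v).
    { apply (value_spec _ _ _ Hv). exists r', s. repeat split; auto.
      exact (generic_up hG Hq Hqs). }
    rewrite Evx in Huv. destruct (j_trans x u Huv) as [y ->]. apply j_mem in Huv.
    destruct (proj1 (IH r' s Hrs y (j y) (hT x Hx y Huv) Hu) eq_refl) as (q1 & Hq1 & Hf).
    destruct (generic_directed hG Hq Hq1) as (q2 & _ & Hq2 & Hq21).
    apply Hn. exists q2, y. repeat split; auto. exact (forces_open _ _ _ _ Hf Hq21).
  - assert (Hyv : j y ∈ v) by (rewrite Evx; apply j_mem; exact Hy).
    apply (value_spec _ _ _ Hv) in Hyv. destruct Hyv as (r' & s & Hrs & Hs & Hu).
    destruct (proj1 (IH r' s Hrs y (j y) (hT x Hx y Hy) Hu) eq_refl) as (q1 & Hq1 & Hf).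
    destruct (generic_directed hG Hq Hq1) as (q2 & Hq2G & Hq2 & Hq21).
    destruct (generic_directed hG Hq2G Hs) as (q3 & _ & Hq32 & Hq3s).
    apply Hn. exists q3, r', s. repeat split; auto.
    + exact (forcing_trans hP Hq32 Hq2).
    + exact (forces_open _ _ _ _ (forces_open _ _ _ _ Hf Hq21) Hq32).
Qed.

End Step.

(** The names at which truth and forcing disagree form a set of W, because all
    the objects compared are sets of W; a minimal one contradicts the two
    inductive steps. *)
Lemma truth_lemma r : r ∈ D -> j r ∈ D' -> truth_at r.
Proof.
  intros Hr HrD'. apply NNPP. intros Hbad.
  destruct (separation (ext_ZF hE) (fun u => u ∈ D' /\
    ~ forall x v, x ∈ j T -> pair_in u v f' ->
      (v = x <-> exists q, q ∈ g /\ triple_in q u x (j F))) (j D)) as [B HB];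
    [definability |].
  (* The bad set of W, seen from V. *)
  assert (Habs : forall s, (forall x v, x ∈ j T -> pair_in (j s) v f' ->
      (v = x <-> exists q, q ∈ g /\ triple_in q (j s) x (j F))) <-> truth_at s).
  { intros s.
    assert (E : forall x, (exists q, q ∈ g /\ triple_in q (j s) (j x) (j F)) <->
        exists q, G q /\ triple_in q s x F).
    { intros x. split.
      - intros (q & Hq & Hf). apply hg in Hq. destruct Hq as (q' & Hq & ->).
        exists q'. split; [exact Hq |].
        apply (triple_in_abs j j_inj j_mem j_trans). exact Hf.
      - intros (q & Hq & Hf). exists (j q). split; [apply g_spec; exact Hq |].
        apply (triple_in_abs j j_inj j_mem j_trans). exact Hf. }
    split.
    - intros H x v Hx Hv. rewrite <- E. apply H; [apply j_mem; exact Hx | exact Hv].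
    - intros H x v Hx Hv. destruct (j_trans T x Hx) as [x' ->]. rewrite E.
      apply H; [apply j_mem; exact Hx | exact Hv]. }
  destruct (minimal_name (ext_ZF hE) B) as (m & Hm & Hmin).
  - exists (j r). apply HB. split; [apply j_mem; exact Hr |].
    split; [exact HrD' | rewrite Habs; exact Hbad].
  - apply HB in Hm. destruct Hm as (HmD & HmD' & Hm).
    destruct (j_trans D m HmD) as [s ->]. apply j_mem in HmD. rewrite Habs in Hm.
    apply Hm.
    assert (IH : forall r' p, pair_in r' p s -> truth_at r').
    { intros r' p Hrp. apply NNPP. intros Hr'.
      destruct (subname s HmD HmD' r' p Hrp) as (H1 & _ & H2).
      apply (Hmin (j r') (j p)).
      - apply (pair_in_abs j j_inj j_mem j_trans). exact Hrp.
      - apply HB. split; [apply j_mem; exact H1 |].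
        split; [exact H2 | rewrite Habs; exact Hr']. }
    intros x v Hx Hv. split.
    + apply truth_complete; assumption.
    + intros (q & Hq & Hf). eapply truth_sound; eassumption.
Qed.

End Truth.

(** * Approximating new cofinal maps in the ground model *)

Lemma powerset_transitive {M : structure} (T Q : M) :
  transitive T -> (forall x, x ∈ Q <-> subset x T) -> transitive Q.
Proof. intros HT HQ x Hx y Hy. apply HQ. apply HT. apply HQ in Hx. auto. Qed.

Section Approximation.
Context {V : structure} (hV : ZF V) (P le one : V) (hP : notion_of_forcing P le one).
Context (G : V -> Prop) (hG : generic P le G).
Context {W : structure} (j : V -> W) (hE : generic_extension P G j).

(** A condition puts x into w when it is below s and forces r = x for some
    (r, s) in a name of w. *)
Lemma nice_name (w : W) (T : V) : transitive T ->
  exists N,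
    (forall p q x, pair_in p x N -> pair_in q p le -> pair_in q x N) /\
    (forall x, x ∈ T -> (j x ∈ w <-> exists p, G p /\ pair_in p x N)).
Proof.
  intros hT. destruct (ext_names hE) as (g & hg & Hnames).
  destruct (Hnames w) as (t & (D & HtD & hD) & (D' & f' & HtD' & hD' & hf' & hval & Hw)).
  destruct (forcing_relation_exists hV P le D T) as [F hF].
  destruct (relation_comprehension hV (fun p x => exists r s,
    pair_in r s t /\ pair_in p s le /\ triple_in p r x F) P T) as (N & _ & HN);
    [definability |].
  exists N. split.
  - intros p q x Hp Hqp. apply HN in Hp. destruct Hp as (_ & Hx & r & s & Hrs & Hps & Hf).
    apply HN. split; [apply (le_in P le one hP q p Hqp) |]. split; [exact Hx |].
    exists r, s. split; [exact Hrs |]. split; [exact (forcing_trans hP Hqp Hps) |].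
    exact (forces_open P le one hP D T F hF p q r x Hf Hqp).
  - intros x Hx.
    rewrite (value_spec P G j hE g hg f' hval t w (j x) Hw).
    assert (Htruth : forall r s, pair_in r s t ->
      (pair_in (j r) (j x) f' <-> exists q, G q /\ triple_in q r x F)).
    { intros r s Hrs.
      destruct (subname P G j hE D hD D' hD' t HtD HtD' r s Hrs) as (Hr & _ & HrD').
      assert (H := truth_lemma hV P le one hP G hG j hE g hg D T F hD hT hF D' f'
        hD' hf' hval r Hr HrD').
      split.
      - intros Hv. apply (H x (j x) Hx Hv). reflexivity.
      - intros Hq. destruct (proj2 hf' (j r) HrD') as (v & Hv & _).
        rewrite <- (proj2 (H x v Hx Hv) Hq). exact Hv. }
    split.
    + intros (r & s & Hrs & Hs & Hv). apply (Htruth r s Hrs) in Hv.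
      destruct Hv as (q & Hq & Hf).
      destruct (generic_directed hG Hq Hs) as (p & Hp & Hpq & Hps).
      exists p. split; [exact Hp |]. apply HN.
      split; [exact (generic_sub hG Hp) |]. split; [exact Hx |].
      exists r, s. repeat split; auto.
      exact (forces_open P le one hP D T F hF q p r x Hf Hpq).
    + intros (p & Hp & HpN). apply HN in HpN.
      destruct HpN as (_ & _ & r & s & Hrs & Hps & Hf).
      exists r, s. split; [exact Hrs |]. split; [exact (generic_up hG Hp Hps) |].
      apply (Htruth r s Hrs). eauto.
Qed.

(** p belongs to A_a, when N is a nice name of a map from b to k. *)
Definition decides_above (b k N a p : V) : Prop :=
  exists n c, n ∈ b /\ c ∈ k /\ (a = c \/ a ∈ c) /\ triple_in p n c N.

(** p belongs to D_a.  The second alternative is independent of a; this keeps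
    the sequence decreasing. *)
Definition decides_or_fails (b k N a p : V) : Prop :=
  decides_above b k N a p \/
  exists a', a' ∈ k /\ ~ exists q, pair_in q p le /\ decides_above b k N a' q.

Hint Unfold decides_above decides_or_fails : set_theory.

Section Decision.
Context (b k N : V) (Hk : ordinal k).
Context (HN : forall p q x, pair_in p x N -> pair_in q p le -> pair_in q x N).

Lemma triple_open p q n c : triple_in p n c N -> pair_in q p le -> triple_in q n c N.
Proof. intros (w & Hw & Hp) Hqp. exists w. eauto. Qed.

Lemma decides_above_open a p q :
  decides_above b k N a p -> pair_in q p le -> decides_above b k N a q.
Proof.
  intros (n & c & Hn & Hc & Hac & H) Hqp. exists n, c. eauto using triple_open.
Qed.

Lemma decides_above_mono a a' p :
  a ∈ a' -> decides_above b k N a' p -> decides_above b k N a p.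
Proof.
  intros Ha (n & c & Hn & Hc & Hac & H). exists n, c. repeat split; auto.
  right. destruct Hac as [<- | Hac]; [exact Ha |].
  exact (ordinal_elem_trans k a a' c Hk Ha Hac Hc).
Qed.

Lemma decides_or_fails_open_dense a : a ∈ k ->
  open_dense P le (fun p => p ∈ P /\ decides_or_fails b k N a p).
Proof.
  intros Ha. split; split.
  - tauto.
  - intros p q [_ H] Hqp. split; [apply (le_in P le one hP q p Hqp) |].
    destruct H as [H | (a' & Ha' & H)].
    + left. eauto using decides_above_open.
    + right. exists a'. split; [exact Ha' |]. intros (r & Hrq & Hr).
      apply H. exists r. split; [exact (forcing_trans hP Hrq Hqp) | exact Hr].
  - tauto.
  - intros p Hp. destruct (classic (exists q, pair_in q p le /\ decides_above b k N a q))
      as [(q & Hqp & Hq) | Hn].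
    + exists q. split; [| exact Hqp]. split; [apply (le_in P le one hP q p Hqp) |].
      left. exact Hq.
    + exists p. split; [| exact (forcing_refl hP Hp)]. split; [exact Hp |].
      right. eauto.
Qed.

(** The sequence of the sets D_a lies in V, since N does. *)
Lemma generic_decides_or_fails :
  descending_distributive P le k ->
  exists p, G p /\ forall a, a ∈ k -> decides_or_fails b k N a p.
Proof.
  intros Hd. destruct (zf_powerset hV P) as [Q HQ].
  destruct (relation_comprehension hV
    (fun a d => forall p, p ∈ d <-> p ∈ P /\ decides_or_fails b k N a p) k Q)
    as (S & HS & HSin); [definability |].
  assert (Hex : forall a, a ∈ k -> exists d, pair_in a d S).
  { intros a Ha. destruct (separation hV (decides_or_fails b k N a) P) as [d Hdd];
      [definability |].
    exists d. apply HSin. split; [exact Ha |]. split; [| exact Hdd].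
    apply HQ. intros p Hp. apply Hdd in Hp. tauto. }
  assert (HSspec : forall a d p, pair_in a d S ->
    (p ∈ d <-> p ∈ P /\ decides_or_fails b k N a p)).
  { intros a d p H. apply HSin in H. apply H. }
  destruct (Hd S) as [_ Hdense].
  - split.
    + intros z Hz. destruct (HS z Hz) as (x & y & Hx & _ & Hxy). eauto.
    + intros a Ha. destruct (Hex a Ha) as [d Hda]. exists d. split; [exact Hda |].
      intros d' Hd'. apply (zf_extensionality hV). intros p.
      rewrite (HSspec _ _ _ Hda), (HSspec _ _ _ Hd'). reflexivity.
  - intros a d Had. assert (Ha : a ∈ k) by (apply HSin in Had; tauto).
    destruct (decides_or_fails_open_dense a Ha) as [[H1 H2] [H3 H4]].
    split; split.
    + intros p Hp. apply (HSspec _ _ _ Had) in Hp. tauto.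
    + intros p q Hp Hqp. apply (HSspec _ _ _ Had). apply (HSspec _ _ _ Had) in Hp. eauto.
    + intros p Hp. apply (HSspec _ _ _ Had) in Hp. tauto.
    + intros p Hp. destruct (H4 p Hp) as (q & Hq & Hqp). exists q.
      split; [apply (HSspec _ _ _ Had) |]; assumption.
  - intros a a' d d' Haa' Had Had' p Hp. apply (HSspec _ _ _ Had).
    apply (HSspec _ _ _ Had') in Hp. destruct Hp as [Hp [H | H]];
      split; auto; [left | right; exact H].
    exact (decides_above_mono a a' p Haa' H).
  - destruct (separation hV (fun p => forall a d, pair_in a d S -> p ∈ d) P) as [I HI];
      [definability |].
    destruct (generic_meets hG (D := I)) as (p & HpI & Hp).
    + split; [intros p Hp; apply HI in Hp; tauto |].
      intros p Hp. destruct Hdense as [_ Hdense]. destruct (Hdense p Hp) as (q & Hq & Hqp).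
      exists q. split; [apply HI; exact Hq | exact Hqp].
    + exists p. split; [exact Hp |]. intros a Ha. destruct (Hex a Ha) as [d Hda].
      apply HI in HpI. destruct HpI as [_ HpI].
      apply (HSspec _ _ _ Hda). exact (HpI a d Hda).
Qed.

End Decision.

(** No new map from a subset of k is the first to be cofinal in k: a single
    condition of the generic filter decides cofinally many of its values. *)
Lemma cofinal_map_in_ground (b k : V) (f : W) :
  ordinal k -> subset b k -> descending_distributive P le k ->
  cofinal_map f (j b) (j k) -> exists f0, cofinal_map f0 b k.
Proof.
  intros Hk Hbk Hd [[[Hdom Hfun] Hran] Hcof].
  assert (j_inj := ext_inj hE). assert (j_mem := ext_mem hE).
  assert (j_trans := ext_transitive hE).
  (* T contains all pairs of elements of k. *)
  destruct (zf_powerset hV k) as [Q HQ]. destruct (zf_powerset hV Q) as [T HT].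
  assert (HTt : transitive T).
  { apply (powerset_transitive Q T); [| exact HT].
    apply (powerset_transitive k Q); [apply Hk | exact HQ]. }
  destruct (nice_name f T HTt) as (N & HNopen & HNtruth).
  assert (Htruth : forall n c, n ∈ b -> c ∈ k ->
    (pair_in (j n) (j c) f <-> exists p, G p /\ triple_in p n c N)).
  { intros n c Hn Hc. destruct (pair_exists hV n c) as [z Hz].
    assert (HzT : z ∈ T).
    { destruct Hz as (u & v & Hu & Hv & Hz). apply HT. intros y Hy. apply HQ.
      intros x Hx. apply Hz in Hy. destruct Hy as [-> | ->].
      - apply Hu in Hx. destruct Hx; subst; auto.
      - apply Hv in Hx. destruct Hx; subst; auto. }
    rewrite (pair_in_iff (ext_ZF hE) (j n) (j c) (j z)
      f (proj2 (pair_abs j j_inj j_mem j_trans n c z) Hz)).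
    rewrite (HNtruth z HzT). split.
    - intros (p & Hp & H). exists p. split; [exact Hp |]. exists z. auto.
    - intros (p & Hp & z' & Hz' & H). exists p. split; [exact Hp |].
      rewrite (pair_unique hV n c z z' Hz Hz'). exact H. }
  destruct (generic_decides_or_fails b k N Hk HNopen Hd) as (p & Hp & Hall).
  assert (Habove : forall a, a ∈ k -> decides_above b k N a p).
  { intros a Ha. destruct (Hall a Ha) as [H | (a' & Ha' & Hn)]; [exact H |].
    destruct Hn.
    destruct (Hcof (j a')) as (n & y & Hny & Hay); [apply j_mem; exact Ha' |].
    destruct (j_trans k y (Hran n y Hny)) as [c ->].
    assert (Hc : c ∈ k) by (apply j_mem; exact (Hran n _ Hny)).
    assert (Hnb : n ∈ j b).
    { destruct Hny as (z & Hz & Hzf). destruct (Hdom z Hzf) as (n' & y' & Hn' & Hz').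
      destruct (pair_inj _ _ _ _ _ Hz Hz') as [-> _]. exact Hn'. }
    destruct (j_trans b n Hnb) as [m ->]. apply j_mem in Hnb.
    destruct (proj1 (Htruth m c Hnb Hc) Hny) as (q & Hq & Hf).
    destruct (generic_directed hG Hp Hq) as (r & _ & Hrp & Hrq).
    exists r. split; [exact Hrp |]. exists m, c. repeat split; auto.
    - destruct Hay as [E | H]; [left; apply j_inj; exact E | right; apply j_mem; exact H].
    - exact (triple_open N HNopen q r m c Hf Hrq). }
  assert (Huniq : forall n c c', n ∈ b -> c ∈ k -> c' ∈ k ->
    triple_in p n c N -> triple_in p n c' N -> c = c').
  { intros n c c' Hn Hc Hc' H H'. apply j_inj.
    destruct (Hfun (j n)) as (y & _ & Hy); [apply j_mem; exact Hn |].
    rewrite <- (Hy (j c)); [apply Hy |]; apply Htruth; eauto. }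
  (* The value c0 makes the partial function total; if b is empty, so is the
     function, and k may be empty too. *)
  assert (Hdefault : exists c0, forall n, n ∈ b -> c0 ∈ k).
  { destruct (classic (exists n, n ∈ b)) as [[n Hn] | Hn].
    - destruct (Hfun (j n)) as (y & Hy & _); [apply j_mem; exact Hn |].
      apply Hran in Hy. destruct (j_trans k y Hy) as [c ->]. exists c.
      intros _ _. apply j_mem. exact Hy.
    - exists k. intros n Hn'. destruct Hn. eauto. }
  destruct Hdefault as [c0 Hc0].
  destruct (relation_comprehension hV (fun n c => triple_in p n c N \/
    (c = c0 /\ ~ exists c', c' ∈ k /\ triple_in p n c' N)) b k) as (f0 & Hf0 & Hin);
    [definability |].
  exists f0. split; [split; [split |] |].
  - intros z Hz. destruct (Hf0 z Hz) as (x & y & Hx & _ & Hxy). eauto.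
  - intros n Hn. destruct (classic (exists c, c ∈ k /\ triple_in p n c N))
      as [(c & Hc & H) | Hnone].
    + exists c. split; [apply Hin; auto |]. intros c' Hc'. apply Hin in Hc'.
      destruct Hc' as (_ & Hc' & [H' | [_ H']]); [eauto |]. destruct H'. eauto.
    + exists c0. split; [apply Hin; split; [exact Hn | split; [exact (Hc0 n Hn) | auto]] |].
      intros c' Hc'. apply Hin in Hc'.
      destruct Hc' as (_ & Hc' & [H' | [-> _]]); [| reflexivity].
      destruct Hnone. eauto.
  - intros n c H. apply Hin in H. tauto.
  - intros a Ha. destruct (Habove a Ha) as (n & c & Hn & Hc & Hac & H).
    exists n, c. split; [apply Hin; auto | exact Hac].
Qed.

End Approximation.

Theorem proposition1p11 (V : structure) (hV : ZF V) (k P le one : V)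
    (hk : cardinal k) (hP : notion_of_forcing P le one)
    (hd : descending_distributive P le k) :
  preserves_cofinality P le k.
Proof.
  intros G hG W j hE. destruct hk as [Hk _].
  destruct (cofinality_exists hV k Hk) as [a Ha]. exists a. split; [exact Ha |].
  destruct Ha as (Hao & [f Hf] & Hmin).
  assert (Hak : subset a k).
  { destruct (Hmin k Hk (identity_cofinal hV k)) as [-> | Hak];
      intros x Hx; [exact Hx | exact (ordinal_trans k x a Hk Hx Hak)]. }
  assert (j_mem := ext_mem hE). assert (j_trans := ext_transitive hE).
  assert (Hjao := ordinal_abs j j_mem j_trans a (ext_ZF hE) Hao).
  split; [exact Hjao |]. split.
  { exists (j f). exact (cofinal_map_abs j (ext_inj hE) j_mem j_trans f a k Hf). }
  intros b Hb [h Hh].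
  destruct (ordinal_trichotomy (ext_ZF hE) (j a) b Hjao Hb) as [H | [H | Hba]]; auto.
  exfalso. destruct (j_trans a b Hba) as [c ->]. apply j_mem in Hba.
  assert (Hcirr : forall x, x ∈ a -> ~ x ∈ x) by apply Hao.
  assert (Hcof : exists f0, cofinal_map f0 c k).
  { apply (cofinal_map_in_ground hV P le one hP G hG j hE c k h Hk); auto.
    intros x Hx. apply Hak. exact (ordinal_trans a x c Hao Hx Hba). }
  destruct (Hmin c (ordinal_elem a c Hao Hba) Hcof) as [-> | Hac].
  - exact (Hcirr c Hba Hba).
  - apply (Hcirr c Hba). exact (ordinal_elem_trans a c a c Hao Hba Hac Hba).
Qed.
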